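(* Let $X$ be a complex Banach space, let $T \in L(X)$ and let $\Phi=(\Phi_1,\Phi_2)$ be a spectral a-partitioning function for $T$. If $\Psi=(\Psi_1,\Psi_2)$ is a spectral valued function such that $\Psi \leq \Phi$, then $\Psi$ is a spectral a-partitioning function for $T$ if and only if $\Psi_1(T) \setminus \Phi_1(T) = \Phi_2(T) \setminus \Psi_2(T)$.
   Context: $L(X)$ is the Banach algebra of bounded linear operators on $X$; $\sigma(T)$ is the spectrum and $\sigma_a(T)$ the approximate point spectrum of $T$; $\mathcal{P}(\mathbb{C})$ is the set of all subsets of $\mathbb{C}$. The symbol $\bigsqcup$ denotes disjoint union: $A = B \bigsqcup C$ means $A = B\cup C$ and $B\cap C=\emptyset$. A spectral valued function is a function $\Phi=(\Phi_1,\Phi_2): L(X)\to \mathcal{P}(\mathbb{C})\times\mathcal{P}(\mathbb{C})$ such that for every $S\in L(X)$, $\Phi_1(S)\subset\sigma(S)$ and $\Phi_2(S)\subset\sigma(S)$. A spectral valued function $\Phi$ is a spectral a-partitioning function for $T\in L(X)$ if $\sigma_a(T)=\Phi_1(T)\bigsqcup\Phi_2(T)$. For spectral valued functions $\Psi,\Phi$, write $\Psi\leq\Phi$ if for all $S\in L(X)$, $\Phi_1(S)\subset\Psi_1(S)$ and $\Psi_2(S)\subset\Phi_2(S)$. *)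

(* Defs.v *)
From HB Require Import structures.
From mathcomp Require Import all_boot all_order all_algebra.
From mathcomp Require Import complex.
From mathcomp Require Import all_classical all_reals all_analysis.

Set Implicit Arguments.
Unset Strict Implicit.
Unset Printing Implicit Defensive.

Import Order.TTheory GRing.Theory Num.Theory.
Import numFieldNormedType.Exports.

Local Open Scope classical_set_scope.
Local Open Scope ring_scope.
Local Open Scope complex_scope.

(* The norm of a normed module over R[i] takes its values in R[i], ordered by
   z <= w iff w - z is a nonnegative real; the inequality below thus makes M
   real whenever X is nontrivial. *)
Record boundedOp (R : realType) (X : normedModType R[i]) := BoundedOp {
  boundedOp_linear :> {linear X -> X};
  boundedOpP : exists M : R[i], forall x : X,
    `|boundedOp_linear x| <= M * `|x|
}.

Lemma boundedOp_ext (R : realType) (X : normedModType R[i])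
    (S T : boundedOp X) : (forall x, S x = T x) -> S = T.
Proof.
case: S T => [f fP] [g gP] /= fg.
have efg : f = g.
  move/funext: fg => {fP gP}.
  case: f => f [[f1] [f2]]; case: g => g [[g1] [g2]] /= fg.
  by subst g; rewrite (Prop_irrelevance f1 g1) (Prop_irrelevance f2 g2).
by subst g; rewrite (Prop_irrelevance fP gP).
Qed.

(* Invertibility of z I - T in L(X): the two-sided inverse S is itself required
   to be bounded. *)
Definition resolvent_set (R : realType) (X : normedModType R[i])
    (T : boundedOp X) : set R[i] :=
  [set z | exists S : boundedOp X,
     (forall x, S (z *: x - T x) = x) /\ (forall x, z *: S x - T (S x) = x)].

Definition spectrum (R : realType) (X : normedModType R[i])
    (T : boundedOp X) : set R[i] := ~` resolvent_set T.

Definition approx_point_spectrum (R : realType) (X : normedModType R[i])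
    (T : boundedOp X) : set R[i] :=
  [set z | exists u : nat -> X, (forall n, `|u n| = 1) /\
     (fun n => z *: u n - T (u n)) @ \oo --> (0 : X)].

Definition disjoint_union (U : Type) (A B C : set U) : Prop :=
  A = B `|` C /\ B `&` C = set0.

Record spectralFun (R : realType) (X : normedModType R[i]) := SpectralFun {
  spectralFun_fun :> boundedOp X -> set R[i] * set R[i];
  spectralFunP : forall S : boundedOp X,
    (spectralFun_fun S).1 `<=` spectrum S /\
    (spectralFun_fun S).2 `<=` spectrum S
}.

Definition a_partitioning (R : realType) (X : normedModType R[i])
    (Phi : spectralFun X) (T : boundedOp X) : Prop :=
  disjoint_union (approx_point_spectrum T) (Phi T).1 (Phi T).2.

(* The order is reversed on the first component. *)
Definition spectralFun_le (R : realType) (X : normedModType R[i])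
    (Psi Phi : spectralFun X) : Prop :=
  forall S : boundedOp X,
    (Phi S).1 `<=` (Psi S).1 /\ (Psi S).2 `<=` (Phi S).2.

(* Main.v *)
Require Import Defs.
From mathcomp Require Import all_boot all_order all_algebra.
From mathcomp Require Import complex.
From mathcomp Require Import all_classical all_reals all_analysis.

Local Open Scope classical_set_scope.
Local Open Scope ring_scope.
Local Open Scope complex_scope.

(** At [T], passing from [Phi] to [Psi] enlarges the first piece of a partition and shrinks the
    second. The result is again a partition of the same set exactly when the points gained on one
    side are those lost on the other. [disjoint_union_shift] is this fact for arbitrary sets. *)

Lemma disjoint_union_shift (U : Type) (A B C B' C' : set U) :
  disjoint_union A B C -> B `<=` B' -> C' `<=` C ->
  disjoint_union A B' C' <-> B' `\` B = C `\` C'.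
Proof.
move=> [-> /disjoints_subset dBC] sB sC; split.
(* Equality of the two unions forces a gained point into [C] and a lost one into [B']; disjointness
   excludes [C'] and [B] respectively. *)
- move=> [eA /disjoints_subset dBC']; apply/seteqP; split => x.
  + move=> [B'x nBx]; split; last exact: dBC'.
    have : (B `|` C) x by rewrite eA; left.
    by case.
  + move=> [Cx nC'x]; split; last by move=> /dBC.
    have : (B' `|` C') x by rewrite -eA; right.
    by case.
- move=> e; split.
  + apply/seteqP; split => x.
    * case=> [/sB|Cx]; first by left.
      have [C'x|nC'x] := pselect (C' x); first by right.
      by left; have [] : (B' `\` B) x by rewrite e.
    * case=> [B'x|/sC]; last by right.
      have [Bx|nBx] := pselect (B x); first by left.
      by right; have [] : (C `\` C') x by rewrite -e.
  + apply/disjoints_subset => x B'x C'x.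
    (* A common point lies in [C], hence outside [B]: it is gained, so by [e] lost from [C'], a
       contradiction. *)
    have : (C `\` C') x by rewrite -e; split=> // /dBC; apply; apply: sC.
    by case.
Qed.

Theorem theorem3p3 (R : realType) (X : completeNormedModType R[i])
    (T : boundedOp X) (Phi : spectralFun X) (hPhi : a_partitioning Phi T)
    (Psi : spectralFun X) (hle : spectralFun_le Psi Phi) :
  a_partitioning Psi T <->
  (Psi T).1 `\` (Phi T).1 = (Phi T).2 `\` (Psi T).2.
Proof.
have [s1 s2] := hle T.
exact: disjoint_union_shift hPhi s1 s2.
Qed.
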